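(* Consider the temporally switching linear system with $p\ge 1$ snapshots \[ \dot{x}(t)=A_i x(t)+B u(t),\qquad t\in[t_{i-1},t_i),\quad i=1,\dots,p, \] where $t_0<t_1<\dots<t_p$, $\Delta t_i=t_i-t_{i-1}>0$, $A_i\in\mathbb{R}^{n\times n}$, $B\in\mathbb{R}^{n\times m}$. Let $C_k=[\,B,\ A_kB,\ A_k^2B,\ \dots,\ A_k^{n-1}B\,]$ be the controllability matrix of the pair $(A_k,B)$ and define the temporal controllability matrix \[ \mathcal{C}_T=\big[\,C_p,\ e^{A_p\Delta t_p}C_{p-1},\ e^{A_p\Delta t_p}e^{A_{p-1}\Delta t_{p-1}}C_{p-2},\ \dots,\ e^{A_p\Delta t_p}\cdots e^{A_2\Delta t_2}C_1\,\big]. \] Then the system is completely herdable on $[t_0,t_p]$ if and only if there exists a vector $v\in\mathbb{R}^n$ with all entries strictly positive such that $v\in\operatorname{Im}(\mathcal{C}_T)=\{\mathcal{C}_T y: y\}$.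
   Context: The system is called completely herdable on $[t_0,t_f]$ if for every initial condition $x(t_0)\in\mathbb{R}^n$ and every threshold $h>0$ there exists a piecewise continuous input $u:[t_0,t_f]\to\mathbb{R}^m$ such that the resulting solution satisfies $x_j(t_f)\ge h$ for every node $j\in\{1,\dots,n\}$ simultaneously. *)

(* Defs.v *)
From HB Require Import structures.
From mathcomp Require Import all_boot all_order all_algebra.
From mathcomp Require Import all_classical all_reals all_analysis.
Set Implicit Arguments. Unset Strict Implicit. Unset Printing Implicit Defensive.
Import Order.TTheory GRing.Theory Num.Theory.
Import numFieldNormedType.Exports.
Local Open Scope classical_set_scope.
Local Open Scope ring_scope.

Section Herdability.
Variable R : realType.

Definition expm (n : nat) (M : 'M[R]_n) : 'M[R]_n :=
  lim ((series (fun k : nat => (k`!%:R)^-1 *: (M ^+ k))) @ \oo).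

Definition piecewise_continuous (k : nat) (a b : R) (u : R -> 'cV[R]_k) : Prop :=
  exists s : seq R,
    (forall tau, a < tau < b -> tau \notin s -> {for tau, continuous u}) /\
    (forall tau, a <= tau < b -> cvg (u x @[x --> tau^'+])) /\
    (forall tau, a < tau <= b -> cvg (u x @[x --> tau^'-])).

Definition switched_solution (n m p : nat) (A : nat -> 'M[R]_n)
    (B : 'M[R]_(n, m)) (t : nat -> R) (u : R -> 'cV[R]_m)
    (x : R -> 'cV[R]_n) : Prop :=
  {within `[t 0%N, t p], continuous x} /\
  forall i : nat, (1 <= i <= p)%N ->
    forall tau, t i.-1 < tau < t i -> {for tau, continuous u} ->
      is_derive tau (1 : R) x (A i *m x tau + B *m u tau).

Definition completely_herdable (n m p : nat) (A : nat -> 'M[R]_n)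
    (B : 'M[R]_(n, m)) (t : nat -> R) : Prop :=
  forall (x0 : 'cV[R]_n) (h : R), 0 < h ->
    exists u : R -> 'cV[R]_m,
      piecewise_continuous (t 0%N) (t p) u /\
      exists x : R -> 'cV[R]_n,
        switched_solution p A B t u x /\ x (t 0%N) = x0 /\
        forall j : 'I_n, h <= x (t p) j 0.

Definition ctrb_mx (n m : nat) (Ak : 'M[R]_n) (B : 'M[R]_(n, m))
  : 'M[R]_(n, \sum_(j < n) m) :=
  @mxrow R n (fun _ : 'I_n => m) n (fun j : 'I_n => Ak ^+ j *m B).

Definition trans_prod (n p : nat) (A : nat -> 'M[R]_n) (t : nat -> R) (k : nat)
  : 'M[R]_n :=
  \prod_(0 <= j < p - k) expm ((t (p - j)%N - t (p - j).-1) *: A (p - j)%N).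

Definition temporal_ctrb_mx (n m p : nat) (A : nat -> 'M[R]_n)
    (B : 'M[R]_(n, m)) (t : nat -> R)
  : 'M[R]_(n, \sum_(k < p) \sum_(j < n) m) :=
  @mxrow R p (fun _ : 'I_p => (\sum_(j < n) m)%N) n
    (fun k : 'I_p => trans_prod p A t (p - k)%N *m ctrb_mx (A (p - k)%N) B).

End Herdability.

(* Main.v *)
Require Import Defs.
From HB Require Import structures.
From mathcomp Require Import all_boot all_order all_algebra ring.
From mathcomp Require Import all_classical all_reals all_analysis.
Import Order.TTheory GRing.Theory Num.Theory.
Import numFieldNormedType.Exports.
Set Implicit Arguments. Unset Strict Implicit. Unset Printing Implicit Defensive.
Local Open Scope classical_set_scope.
Local Open Scope ring_scope.

(**
Write [Phi_i = e^{A_p dt_p} ... e^{A_(i+1) dt_(i+1)}] (this is [trans_prod]).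

Necessity: let [Q] annihilate [C_T].  On the [i]-th interval the function
[s |-> Q Phi_i e^{A_i (t_i - s)} x(s)] has derivative
[Q Phi_i e^{A_i (t_i - s)} B u(s)] off finitely many points, which vanishes
because [Q Phi_i A_i^j B = 0] for [j < n], hence for all [j] by
Cayley-Hamilton.  Telescoping gives [Q x(t_p) = Q Phi_0 x(t_0)], so the state
reached from [0] lies in the image of [C_T].

Sufficiency: on a single interval every shift in the image of [C_i] is realised
by a polynomial input.  With [A^n = sum_j c_j A^j], the function
[x(s) = sum_(j < n) A^j B f_j(s)] solves [x' = A x + B u] as soon as
[f_j' = f_(j-1) + c_j f_(n-1)], with [u] in the role of [f_(-1)].  So all the
[f_j] and [u] are determined by the flat output [g = f_(n-1)], and a
combination [g] of the polynomials [X^n (X - T)^k], [k < n], vanishes to the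
required order at [0] and takes prescribed values [f_j(T)], by a triangular
system.
*)

(** * Calculus of matrix-valued functions and the matrix exponential *)

Section MatrixCalculus.
Variable R : realType.

Lemma cvg_mxP (T : Type) (F : set_system T) (FF : Filter F) (m n : nat)
    (f : T -> 'M[R]_(m, n)) (l : 'M[R]_(m, n)) :
  f @ F --> l <-> forall i j, f x i j @[x --> F] --> l i j.
Proof.
split=> [fl i j|fl].
  by apply: (@cvg_comp _ _ _ f (fun M : 'M[R]_(m, n) => M i j) F _ _ fl);
    exact: coord_continuous.
apply/cvg_mx_entourageP => A entA.
(* There are finitely many index pairs, so the entrywise neighbourhoods meet in one set of the
   filter. *)
have : \forall x \near F, forall ij : 'I_m * 'I_n, (l ij.1 ij.2, f x ij.1 ij.2) \in A.
  apply: filter_forall => -[i j] /=.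
  have /fl Fx : nbhs (l i j) (xsection A (l i j)) by exact: nbhs_entourage.
  by refine (@filterS _ F FF _ _ _ Fx) => x /=; rewrite /xsection /= inE.
by rewrite near_simpl; apply: filterS => x Ax i j; exact: (Ax (i, j)).
Qed.

Lemma cvg_ext (T : Type) (U : topologicalType) (F : set_system T)
    (f g : T -> U) (l : U) : f =1 g -> f @ F --> l -> g @ F --> l.
Proof. by move=> /funext ->. Qed.

Lemma cvg_sumr (T I : Type) (F : set_system T) (FF : Filter F) (s : seq I)
    (f : T -> I -> R) (l : I -> R) :
  (forall i, f x i @[x --> F] --> l i) ->
  \sum_(i <- s) f x i @[x --> F] --> \sum_(i <- s) l i.
Proof.
move=> fl; elim: s => [|i s IH].
  by under eq_fun do rewrite big_nil; rewrite big_nil; exact: cvg_cst.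
by under eq_fun do rewrite big_cons; rewrite big_cons; exact: cvgD.
Qed.

Lemma cvg_mulmx (T : Type) (F : set_system T) (FF : Filter F) (m n q : nat)
    (f : T -> 'M[R]_(m, n)) (g : T -> 'M[R]_(n, q)) (l : 'M[R]_(m, n))
    (h : 'M[R]_(n, q)) :
  f @ F --> l -> g @ F --> h -> f x *m g x @[x --> F] --> l *m h.
Proof.
move=> /cvg_mxP fl /cvg_mxP gh; apply/cvg_mxP => i j.
rewrite mxE (_ : (fun x => _) = fun x => \sum_k f x i k * g x k j); last first.
  by apply/funext => x; rewrite mxE.
by apply: cvg_sumr => k; apply: cvgM.
Qed.

Lemma is_derive_mxP (m n : nat) (M : R -> 'M[R]_(m, n)) (t v : R)
    (D : 'M[R]_(m, n)) :
  is_derive t v M D <-> forall i j, is_derive t v (fun x => M x i j) (D i j).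
Proof.
split=> [[dM <-] i j|dM].
  have /derivable_mxP dMij := dM.
  by apply: DeriveDef; [exact: dMij | rewrite derive_mx// mxE].
have dM' : derivable M t v by apply/derivable_mxP => i j; case: (dM i j).
apply: DeriveDef => //; rewrite derive_mx//; apply/matrixP => i j.
by rewrite mxE; case: (dM i j).
Qed.

Lemma is_derive_mulmx (m n q : nat) (f : R -> 'M[R]_(m, n))
    (g : R -> 'M[R]_(n, q)) (t : R)
    (df : 'M[R]_(m, n)) (dg : 'M[R]_(n, q)) :
  is_derive t 1 f df -> is_derive t 1 g dg ->
  is_derive t 1 (fun x => f x *m g x) (df *m g t + f t *m dg).
Proof.
move=> /is_derive_mxP dfE /is_derive_mxP dgE; apply/is_derive_mxP => i j.
rewrite (_ : (fun x => _) = \sum_k ((fun x => f x i k) * (fun x => g x k j))); last first.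
  by apply/funext => x; rewrite mxE fct_sumE.
have -> : (df *m g t + f t *m dg) i j =
    \sum_k (f t i k *: dg k j + g t k j *: df i k).
  rewrite !mxE -big_split; apply: eq_bigr => k _ /=.
  by rewrite addrC [df i k * _]mulrC.
by apply: is_derive_sum => k; apply: is_deriveM.
Qed.

Lemma is_derive_mx_comp (m n : nat) (f : R -> 'M[R]_(m, n)) (g : R -> R)
    (t dg : R) (df : 'M[R]_(m, n)) :
  is_derive (g t) 1 f df -> is_derive t 1 g dg ->
  is_derive t 1 (fun x => f (g x)) (dg *: df).
Proof.
move=> /is_derive_mxP dfE dgt; apply/is_derive_mxP => i j.
rewrite mxE mulrC.
exact: (@is_derive1_comp R (fun x => f x i j) g).
Qed.

Lemma is_derive_mx_continuous (m n : nat) (f : R -> 'M[R]_(m, n)) (t : R)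
    (df : 'M[R]_(m, n)) :
  is_derive t 1 f df -> {for t, continuous f}.
Proof.
move=> /is_derive_mxP fd; apply/cvg_mxP => i j.
have : differentiable (fun x => f x i j) t.
  by apply/derivable1_diffP; case: (fd i j).
exact: differentiable_continuous.
Qed.

Lemma expmx_scale (n : nat) (A : 'M[R]_n) (s : R) k :
  (s *: A) ^+ k = s ^+ k *: A ^+ k.
Proof.
elim: k => [|k IH]; first by rewrite !expr0 scale1r.
by rewrite !exprS IH -!mulmxE -scalemxAl -scalemxAr scalerA.
Qed.

(** The constant [K] dominates the absolute sum of every row of [A], so each further factor [A]
    multiplies the entry bound by at most [K]. *)
Lemma expmx_entry_bound (n : nat) (A : 'M[R]_n) :
  exists2 K : R, 0 <= K & forall k i j, `|(A ^+ k) i j| <= K ^+ k.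
Proof.
pose K := 1 + \sum_i \sum_j `|A i j|.
have S0 i : 0 <= \sum_j `|A i j| by apply: sumr_ge0.
have K0 : 0 <= K by rewrite addr_ge0// sumr_ge0.
exists K => //; elim=> [|k IH] i j.
  by rewrite !expr0 mxE; case: eqP => _; rewrite ?normr1 ?normr0.
rewrite exprS -mulmxE mxE (le_trans (ler_norm_sum _ _ _))//.
apply: (@le_trans _ _ (\sum_l `|A i l| * K ^+ k)).
  by apply: ler_sum => l _; rewrite normrM ler_wpM2l.
rewrite -mulr_suml exprS ler_wpM2r ?exprn_ge0//.
by rewrite /K [X in _ <= 1 + X](bigD1 i)//= addrCA lerDl addr_ge0// sumr_ge0.
Qed.

(** The shift [d] covers at once the entries of the exponential ([d = 0]) and their formal
    derivatives of order [d]. The majorant is [K ^+ d] times the exponential series at [K * |x|]. *)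
Lemma is_cvg_pseries_expm (n d : nat) (A : 'M[R]_n) i j x :
  cvgn (pseries (fun k => (A ^+ (k + d)) i j / k`!%:R) x).
Proof.
have [K K0 AK] := expmx_entry_bound A.
apply: normed_cvg.
have Ks : cvgn (series (fun k => K ^+ d * exp_coeff (K * `|x|) k)).
  by apply: (@is_cvg_seriesZ R _ (K ^+ d)); exact: is_cvg_series_exp_coeff.
apply: series_le_cvg Ks => [k|k|k] //=.
  by rewrite mulr_ge0 ?exprn_ge0// exp_coeff_ge0// mulr_ge0.
rewrite /exp_coeff/= !normrM normfV normrX exprMn [`|k`!%:R|]ger0_norm//.
rewrite -mulrA [_^-1 * _]mulrC [X in _ <= X](_ : _ = K ^+ (k + d) * (`|x| ^+ k / k`!%:R)).
  by rewrite ler_wpM2r// mulr_ge0// exprn_ge0.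
by rewrite exprD !mulrA [K ^+ d * _]mulrC.
Qed.

(** [expm] is a bare [lim], so identities about it can be read off partial sums only once
    convergence is known. *)
Lemma cvg_expm (n : nat) (A : 'M[R]_n) :
  series (fun k : nat => (k`!%:R)^-1 *: A ^+ k) @ \oo --> expm A.
Proof.
suff : cvgn (series (fun k : nat => (k`!%:R)^-1 *: A ^+ k)) by [].
pose l : 'M[R]_n := \matrix_(i, j) limn (pseries (fun k => (A ^+ (k + 0)) i j / k`!%:R) 1).
apply/cvg_ex; exists l; apply/cvg_mxP => i j.
rewrite mxE; apply: cvg_ext (@is_cvg_pseries_expm n 0 A i j 1) => N.
rewrite /pseries /series /= summxE; apply: eq_bigr => k _.
by rewrite !mxE addn0 expr1n mulr1 mulrC.
Qed.

Lemma cvg_expm_mul (r n c : nat) (P : 'M[R]_(r, n)) (A : 'M[R]_n)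
    (Q : 'M[R]_(n, c)) :
  series (fun k : nat => (k`!%:R)^-1 *: (P *m A ^+ k *m Q)) @ \oo
    --> P *m expm A *m Q.
Proof.
have H : (P *m series (fun k : nat => (k`!%:R)^-1 *: A ^+ k) N *m Q) @[N --> \oo]
    --> P *m expm A *m Q.
  apply: cvg_mulmx; last exact: cvg_cst.
  by apply: cvg_mulmx; [exact: cvg_cst | exact: cvg_expm].
apply: cvg_ext H => N; rewrite /series /= mulmx_sumr mulmx_suml; apply: eq_bigr => k _.
by rewrite -scalemxAr -scalemxAl.
Qed.

Lemma expm_eq0 (r n c : nat) (P : 'M[R]_(r, n)) (A : 'M[R]_n)
    (Q : 'M[R]_(n, c)) :
  (forall k, P *m A ^+ k *m Q = 0) -> P *m expm A *m Q = 0.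
Proof.
move=> PQ0; apply: (cvg_unique _ (@cvg_expm_mul _ _ _ P A Q)) => //.
rewrite (_ : series _ = cst 0); first exact: cvg_cst.
by apply/funext => N; rewrite /series /= big1// => k _; rewrite PQ0 scaler0.
Qed.

Lemma expm_comm (n : nat) (A : 'M[R]_n) (s : R) :
  A *m expm (s *: A) = expm (s *: A) *m A.
Proof.
have H1 := @cvg_expm_mul _ _ _ A (s *: A) 1%:M.
have H2 := @cvg_expm_mul _ _ _ 1%:M (s *: A) A.
rewrite mulmx1 in H1; rewrite mul1mx in H2.
apply: (cvg_unique _ H1) => //.
apply: cvg_ext H2 => N; rewrite /series /=; apply: eq_bigr => k _; congr (_ *: _).
by rewrite mul1mx mulmx1 expmx_scale -scalemxAl -scalemxAr !mulmxE -exprS -exprSr.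
Qed.

Lemma expm0 (n : nat) : expm (0 : 'M[R]_n) = 1%:M.
Proof.
apply: (cvg_unique _ (@cvg_expm n 0)) => //.
(* Every nonempty partial sum is already the identity, since the positive powers of 0 vanish. *)
apply: cvg_near_cst; near=> N.
rewrite /series /= -(@prednK N); last by near: N; exact: nbhs_infty_gt.
rewrite big_nat_recl//= big1 ?addr0 => [|k _]; last by rewrite exprS mul0r scaler0.
by rewrite fact0 invr1 scale1r expr0.
Unshelve. all: by end_near. Qed.

(** Each entry is a power series in [s], differentiated termwise; the differentiated series has the
    entries of [A ^+ (k + 1)] as coefficients, which gives the factor [A]. *)
Lemma is_derive_expm (n : nat) (A : 'M[R]_n) (s : R) :
  is_derive s 1 (fun s => expm (s *: A)) (A *m expm (s *: A)).
Proof.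
have E r : series (fun k : nat => (k`!%:R)^-1 *: (r *: A) ^+ k) @ \oo --> expm (r *: A).
  exact: cvg_expm.
apply/is_derive_mxP => i j.
(* Termwise differentiation at [s] asks for convergence of the series and its first two formal
   derivatives at a point of larger modulus, here [|s| + 1]. *)
have c0 := @is_cvg_pseries_expm n 0 A i j (`|s| + 1).
have c1 := @is_cvg_pseries_expm n 1 A i j (`|s| + 1).
have c2 := @is_cvg_pseries_expm n 2 A i j (`|s| + 1).
have cd d : pseries_diffs (fun k => (A ^+ (k + d)) i j / k`!%:R) =
    fun k => (A ^+ (k + d.+1)) i j / k`!%:R.
  apply/funext => k; rewrite /pseries_diffs factS natrM invfM addSnnS.
  by rewrite mulrCA mulVKf.
have := @pseries_snd_diffs R (fun k => (A ^+ (k + 0)) i j / k`!%:R) (`|s| + 1) s.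
have sK : `|s| < `| `|s| + 1| by rewrite [ltRHS]ger0_norm ?addr_ge0// ltrDl.
rewrite !cd => /(_ c0 c1 c2 sK) D.
have -> : (fun r => expm (r *: A) i j) =
    (fun r => limn (pseries (fun k => (A ^+ (k + 0)) i j / k`!%:R) r)).
  apply/funext => r; apply/esym/cvg_lim => //.
  have /cvg_mxP/(_ i j) Erij := E r.
  apply: cvg_ext Erij => N; rewrite /pseries /series /= summxE.
  by apply: eq_bigr => k _; rewrite addn0 expmx_scale !mxE mulrCA mulrC [_^-1 * _]mulrC.
apply: (is_derive_eq D).
apply/cvg_lim => //.
have /cvg_mxP/(_ i j) := @cvg_expm_mul _ _ _ A (s *: A) 1%:M.
rewrite mulmx1; apply: cvg_ext => N; rewrite /pseries /series /= summxE; apply: eq_bigr => k _.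
rewrite mulmx1 expmx_scale -scalemxAr mulmxE -exprS addn1 !mxE.
by rewrite mulrCA mulrC [_^-1 * _]mulrC.
Qed.

End MatrixCalculus.

(** * Cayley-Hamilton and flat outputs *)

(** Induction on the exceptional points: one lying inside the interval splits it in two, and
    continuity joins the halves. Without exceptional points this is the mean value theorem. *)
Lemma derive0_off_seq_cst (R : realType) (f : R -> R) (s : seq R) (a b : R) :
  a <= b -> {within `[a, b], continuous f} ->
  (forall x, a < x < b -> x \notin s -> is_derive x 1 f 0) -> f a = f b.
Proof.
elim: s a b => [|c s IH] a b.
  move=> ab fc df.
  have [x|c _] := @MVT_segment _ f (cst 0) a b ab _ fc.
    by rewrite in_itv => /df; exact.
  by rewrite mul0r => /eqP; rewrite subr_eq0 => /eqP.
move=> ab fc df; have [/andP[ac cb]|cab] := boolP (a < c < b); last first.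
  apply: IH => // x xab xs; apply: df => //; rewrite inE negb_or xs andbT.
  by apply: contraNneq cab => <-.
transitivity (f c).
  apply: IH => [||x /andP[ax xc] xs]; first exact: ltW.
    apply: continuous_subspaceW fc => x /=; rewrite !in_itv/= => /andP[-> /le_trans]; apply.
    exact: ltW.
  by apply: df; rewrite ?ax ?(lt_trans xc)// inE negb_or xs lt_eqF.
apply: IH => [||x /andP[cx xb] xs]; first exact: ltW.
  apply: continuous_subspaceW fc => x /=; rewrite !in_itv/= => /andP[cx ->]; rewrite andbT.
  by apply: le_trans cx; exact: ltW.
by apply: df; rewrite ?xb ?(lt_trans ac)// inE negb_or xs gt_eqF.
Qed.

Lemma expmx_reduce (R : comNzRingType) (n : nat) (A : 'M[R]_n) :
  exists c : nat -> R, A ^+ n = \sum_(j < n) c j *: A ^+ j.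
Proof.
case: n A => [|n] A; first by exists (fun=> 0); apply/matrixP => -[].
exists (fun j => - (char_poly A)`_j).
have := Cayley_Hamilton A.
rewrite -[X in horner_mx A X = _]coefK poly_def size_char_poly linear_sum /= big_ord_recr /=.
have /monicP := char_poly_monic A; rewrite lead_coefE size_char_poly /= => ->.
have hX k : horner_mx A 'X^k = A ^+ k by rewrite rmorphXn /= horner_mx_X.
rewrite scale1r hX => /eqP; rewrite addrC addr_eq0 => /eqP ->.
rewrite -sumrN; apply: eq_bigr => j _; rewrite scaleNr; congr (- _).
by rewrite linearZ /= hX.
Qed.

(** Strong induction on [k]: for [k >= n], replacing one factor [A ^+ n] by lower powers leaves only
    exponents below [k]. *)
Lemma mulmx_expmx_eq0 (R : comNzRingType) (r n q : nat) (P : 'M[R]_(r, n))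
    (A : 'M[R]_n) (Q : 'M[R]_(n, q)) :
  (forall j, (j < n)%N -> P *m A ^+ j *m Q = 0) ->
  forall k, P *m A ^+ k *m Q = 0.
Proof.
move=> PQ0 k; have [c Ac] := expmx_reduce A.
elim/ltn_ind: k => k IH; have [kn|nk] := ltnP k n; first exact: PQ0.
rewrite -(subnK nk) exprD Ac -mulmxE mulmx_sumr mulmx_sumr mulmx_suml big1// => j _.
rewrite -!scalemxAr -scalemxAl mulmxE -exprD IH ?scaler0//.
by rewrite -[X in (_ < X)%N](subnK nk) ltn_add2l.
Qed.

Section FlatOutput.
Variables (R : numFieldType) (n : nat) (c : nat -> R).

(* [flat_chain g k] is the function [f_(n-1-k)] determined by the flat output [g];
   [flat_chain g n] is the input. *)
Fixpoint flat_chain (g : {poly R}) (k : nat) : {poly R} :=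
  if k is i.+1 then (flat_chain g i)^`() - c (n.-1 - i)%N *: g else g.

Lemma flat_chain_lin g h a k :
  flat_chain (g + a *: h) k = flat_chain g k + a *: flat_chain h k.
Proof.
elim: k => [//|k IH] /=; rewrite IH derivD derivZ -!mul_polyC.
ring.
Qed.

(** Each step of the chain costs one order of vanishing at [a]. The subtracted multiple of the flat
    output vanishes to higher order, so the leading value is that of the plain [k]-th derivative. *)
Lemma flat_chain_factor (q : {poly R}) a m k : (k <= m)%N ->
  exists2 r : {poly R}, flat_chain (q * ('X - a%:P) ^+ m) k = r * ('X - a%:P) ^+ (m - k) &
    r.[a] = (m ^_ k)%:R * q.[a].
Proof.
elim: k => [|k IH] km; first by exists q; rewrite ?subn0 ?ffactn0 ?mul1r.
have [r /= -> ra] := IH (ltnW km).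
set e := (m - k.+1)%N; have ek : (m - k = e.+1)%N by rewrite /e subnSK.
have em : (m = k.+1 + e)%N by rewrite /e subnKC.
exists (r^`() * ('X - a%:P) + r *+ e.+1 - c (n.-1 - k)%N *: (q * ('X - a%:P) ^+ k.+1)).
  rewrite ek derivM deriv_exp derivXsubC mul1r /= [X in q * _ ^+ X]em exprD -!mul_polyC.
  rewrite !exprS.
  ring.
rewrite 2!hornerD hornerN hornerZ !hornerM hornerMn horner_exp hornerXsubC subrr exprS.
rewrite mul0r !mulr0 subr0 add0r ra ffactnSr ek natrM.
ring.
Qed.

(** Induction on [k] solves the triangular system: the correction [h] keeps the zeros at 0 and the
    values at [T] already fixed, and moves the [k]-th one. *)
Lemma steer_flat (T : R) (z : nat -> R) k : T != 0 -> exists g : {poly R},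
  (forall i, (i < n)%N -> (flat_chain g i).[0] = 0) /\
  (forall i, (i < k)%N -> (flat_chain g i).[T] = z i).
Proof.
move=> T0; elim: k => [|k [g [g0 gT]]].
  exists 0; split=> // i _; rewrite (_ : flat_chain 0 i = 0) ?horner0//.
  by elim: i => [//|i /= ->]; rewrite deriv0 scaler0 subr0.
pose h : {poly R} := 'X^n * ('X - T%:P) ^+ k.
have h0 i : (i < n)%N -> (flat_chain h i).[0] = 0.
  move=> lin; have -> : h = (('X - T%:P) ^+ k) * ('X - 0%:P) ^+ n by rewrite subr0 mulrC.
  have [r -> _] := flat_chain_factor (('X - T%:P) ^+ k) 0 (ltnW lin).
  by rewrite hornerM horner_exp hornerXsubC subrr expr0n subn_eq0 leqNgt lin mulr0.
have hT i : (i < k)%N -> (flat_chain h i).[T] = 0.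
  move=> lik; have [r -> _] := flat_chain_factor 'X^n T (ltnW lik).
  by rewrite hornerM horner_exp hornerXsubC subrr expr0n subn_eq0 leqNgt lik mulr0.
(* The diagonal coefficient of the system is [k! T^n]. *)
have hk : (flat_chain h k).[T] != 0.
  have [r -> rT] := flat_chain_factor 'X^n T (leqnn k).
  rewrite subnn expr0 mulr1 rT ffactnn hornerXn; apply: mulf_neq0; last exact: expf_neq0.
  by rewrite pnatr_eq0 -lt0n fact_gt0.
exists (g + ((z k - (flat_chain g k).[T]) / (flat_chain h k).[T]) *: h); split=> i.
  by move=> lin; rewrite flat_chain_lin hornerD hornerZ g0// h0// mulr0 addr0.
rewrite flat_chain_lin hornerD hornerZ ltnS leq_eqVlt => /predU1P[->|lik].
  by rewrite divfK// addrC subrK.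
by rewrite (hT i lik) mulr0 addr0 gT.
Qed.

Lemma steer_poly (T : R) (y : nat -> R) : T != 0 ->
  exists (f : nat -> {poly R}) (u : {poly R}),
   [/\ forall j, (j < n)%N -> (f j).[0] = 0,
       forall j, (j < n)%N -> (f j).[T] = y j &
       forall j, (j < n)%N ->
         (f j)^`() = (if j is i.+1 then f i else u) + c j *: f n.-1 ].
Proof.
move=> T0; have [g [g0 gT]] := @steer_flat T (fun k => y (n.-1 - k)%N) n T0.
exists (fun j => flat_chain g (n.-1 - j)), (flat_chain g n).
have sub j : (j < n)%N -> (n.-1 - j < n)%N by case: (n) => // n' _; rewrite ltnS leq_subr.
split=> j jn; first by rewrite g0// sub.
  by rewrite gT ?sub// subKn// -ltnS prednK// (leq_ltn_trans _ jn).
rewrite subnn /=.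
(* Chain index and power of [A] run in opposite directions; for [j = 0] the next chain index is [n],
   that of the input. *)
have -> : (if j is i.+1 then flat_chain g (n.-1 - i) else flat_chain g n) =
    flat_chain g (n.-1 - j).+1.
  case: j jn => [|j] jn; first by rewrite subn0 prednK.
  by rewrite subnSK// -ltnS prednK// (leq_ltn_trans _ jn).
by rewrite /= subKn ?subrK// -ltnS prednK// (leq_ltn_trans _ jn).
Qed.

End FlatOutput.

(** * Steering on one interval *)

Section Steering.
Variable R : realType.

Lemma ctrb_mx_mul (n m : nat) (A : 'M[R]_n) (B : 'M[R]_(n, m))
    (y : 'cV[R]_(\sum_(j < n) m)) :
  ctrb_mx A B *m y = \sum_(j < n) A ^+ j *m B *m submxcol y j.
Proof. by rewrite -{1}[y]submxcolK /ctrb_mx mul_mxrow_mxcol. Qed.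

(** The [c j] terms add up to [A ^+ n *m B *m F n.-1], exactly the top term missing from the shifted
    sum, which thereby becomes [A] times the original one. *)
Lemma companion_sum (n m : nat) (A : 'M[R]_n) (B : 'M[R]_(n, m))
    (c : nat -> R) (F : nat -> 'cV[R]_m) (U : 'cV[R]_m) :
  A ^+ n = \sum_(j < n) c j *: A ^+ j ->
  \sum_(j < n) A ^+ j *m B *m
    ((if j : nat is i.+1 then F i else U) + c j *: F n.-1) =
  A *m (\sum_(j < n) A ^+ j *m B *m F j) + B *m U.
Proof.
move=> Ac; under eq_bigr do rewrite mulmxDr -scalemxAr.
rewrite big_split /=.
have -> : \sum_(j < n) c j *: (A ^+ j *m B *m F n.-1) = A ^+ n *m B *m F n.-1.
  by rewrite Ac !mulmx_suml; apply: eq_bigr => j _; rewrite -!scalemxAl.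
case: n A B {Ac} => [|n] A B; first by apply/matrixP => -[].
rewrite big_ord_recl /= expr0 mul1mx -addrA addrC; congr (_ + _).
rewrite big_ord_recr /= mulmxDr mulmx_sumr; congr (_ + _).
  by apply: eq_bigr => j _; rewrite !mulmxA mulmxE -exprS.
by rewrite !mulmxA mulmxE -exprS.
Qed.

(** The trajectory is the free motion from [x0] plus the flat one, which starts at 0 and ends at the
    combination of the blocks [A ^+ j *m B] prescribed by [y]. *)
Lemma steer_interval (n m : nat) (A : 'M[R]_n) (B : 'M[R]_(n, m)) (a b : R)
    (x0 : 'cV[R]_n) (y : 'cV[R]_(\sum_(j < n) m)) : a < b ->
  exists (u : R -> 'cV[R]_m) (x : R -> 'cV[R]_n),
    [/\ continuous u,
        forall s, is_derive s (1 : R) x (A *m x s + B *m u s),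
        x a = x0 &
        x b = expm ((b - a) *: A) *m x0 + ctrb_mx A B *m y].
Proof.
move=> ab; have T0 : b - a != 0 by rewrite subr_eq0 gt_eqF.
have [c Ac] := expmx_reduce A.
(* The target is extended by 0 to all natural indices; only [j < n] matters below. *)
pose z (l : 'I_m) (j : nat) : R :=
  if insub j is Some k then (submxcol y k : 'cV[R]_m) l 0 else 0.
(* The input channels [l] are solved independently, each with its own flat output. *)
have /choice[f /choice[v fv]] := fun l => @steer_poly R n c (b - a) (z l) T0.
have f0 l j : (j < n)%N -> (f l j).[0] = 0 by have [+ _ _] := fv l; apply.
have fT l j : (j < n)%N -> (f l j).[b - a] = z l j by have [_ + _] := fv l; apply.
have fd l j : (j < n)%N ->
  (f l j)^`() = (if j is i.+1 then f l i else v l) + c j *: f l n.-1.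
  by have [_ _] := fv l; apply.
pose F j s : 'cV[R]_m := \col_l (f l j).[s].
pose U s : 'cV[R]_m := \col_l (v l).[s].
pose X (s : R) : 'cV[R]_n := expm (s *: A) *m x0 + \sum_(j < n) A ^+ j *m B *m F j s.
have dF j (s : R) : (j < n)%N ->
    is_derive s 1 (F j) ((if j is i.+1 then F i s else U s) + c j *: F n.-1 s).
  move=> jn; apply/is_derive_mxP => l k.
  rewrite (_ : (fun s => _) = horner (f l j)); last by apply/funext => r; rewrite mxE.
  apply: is_derive_eq; rewrite fd// hornerD hornerZ.
  by case: j jn => [|j] jn; rewrite !mxE.
have dX (s : R) : is_derive s 1 X (A *m X s + B *m U s).
  apply: (@is_derive_eq _ _ _ _ _ _ _ (A *m expm (s *: A) *m x0 + expm (s *: A) *m 0 +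
     \sum_(j < n) (0 *m F j s + A ^+ j *m B *m
        ((if j : nat is i.+1 then F i s else U s) + c j *: F n.-1 s)))).
    have -> : X = (fun s => expm (s *: A) *m x0) +
        \sum_(j < n) (fun s => A ^+ j *m B *m F j s).
      by apply/funext => r; rewrite /X fctE fct_sumE.
    apply: is_deriveD.
      by apply: is_derive_mulmx; exact: is_derive_expm.
    apply: is_derive_sum => j.
    by apply: (@is_derive_mulmx _ _ _ _ (fun=> A ^+ j *m B)); exact: dF.
  rewrite /X mulmxDr mulmx0 addr0 mulmxA -addrA; congr (_ + _).
  by under eq_bigr do rewrite mul0mx add0r; exact: companion_sum.
have dsub (s : R) : is_derive s 1 (fun r : R => r - a) 1.
  by apply: is_derive_eq; rewrite subr0.
(* The polynomials live on an interval starting at 0; the system is autonomous there, so a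
   translation by [a] suffices. *)
exists (fun s => U (s - a)), (fun s => X (s - a)); split.
- move=> s; apply/cvg_mxP => l k; rewrite mxE.
  apply: (@cvg_ext _ _ _ (fun r => (v l).[r - a])) => [r|]; first by rewrite mxE.
  apply: (@cvg_comp _ _ _ (fun r => r - a) (horner (v l))); last exact: continuous_horner.
  by apply: cvgB; [exact: cvg_id | exact: cvg_cst].
- move=> s.
  have := @is_derive_mx_comp _ _ _ X (fun r => r - a) s _ _ (dX (s - a)) (dsub s).
  by rewrite scale1r.
- rewrite /X subrr scale0r expm0 mul1mx big1 ?addr0// => j _.
  by rewrite (_ : F j 0 = 0) ?mulmx0//; apply/matrixP => l k; rewrite !mxE f0.
- rewrite ctrb_mx_mul /X; congr (_ + _); apply: eq_bigr => j _; congr (_ *m _).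
  apply/matrixP => l k; rewrite ord1 mxE fT// /z insubT//= => jn.
  by congr ((submxcol y _ : 'cV[R]_m) l 0); apply: val_inj.
Qed.

End Steering.

(** * Gluing along the switching times *)

Section Gluing.
Variable R : realType.

Lemma is_cvg_near_eq (T : Type) (U : ptopologicalType) (F : set_system T)
    (FF : Filter F) (f g : T -> U) :
  {near F, f =1 g} -> cvg (f @ F) -> cvg (g @ F).
Proof.
move=> fg /cvg_ex[l fl]; apply/cvg_ex; exists l; apply: cvg_trans fl.
by apply: near_eq_cvg.
Qed.

Lemma continuous_near_eq (T U : topologicalType) (f g : T -> U) (x : T) :
  {near x, f =1 g} -> {for x, continuous f} -> {for x, continuous g}.
Proof.
move=> fg fx; rewrite /prop_for /continuous_at -(nbhs_singleton fg).
by apply: cvg_trans fx; exact: near_eq_cvg.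
Qed.

Lemma switch_mono (t : nat -> R) (k : nat) :
  (forall i, (i < k)%N -> t i < t i.+1) ->
  forall i j, (i <= j <= k)%N -> t i <= t j.
Proof.
move=> tS i j /andP[ij]; rewrite -(subnKC ij); elim: (j - i)%N => [|d IH] dk.
  by rewrite addn0.
rewrite addnS in dk *; apply: le_trans (IH (ltnW dk)) _; exact/ltW/tS.
Qed.

Definition cut_fun (V : Type) (c : R) (f g : R -> V) (s : R) : V :=
  if s < c then f s else g s.

Lemma cut_fun_near_lt (V : Type) (c : R) (f g : R -> V) (s : R) :
  s < c -> {near s, f =1 cut_fun c f g}.
Proof.
by move=> sc; near=> r; rewrite /cut_fun ifT//; near: r; exact: lt_nbhsl.
Unshelve. all: by end_near. Qed.

Lemma cut_fun_near_gt (V : Type) (c : R) (f g : R -> V) (s : R) :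
  c < s -> {near s, g =1 cut_fun c f g}.
Proof.
move=> cs; near=> r; rewrite /cut_fun ifF//; apply/negbTE; rewrite -leNgt ltW//.
by near: r; exact: lt_nbhsr.
Unshelve. all: by end_near. Qed.

Lemma cut_fun_left (V : ptopologicalType) (c : R) (f g : R -> V) (s : R) :
  cvg (f x @[x --> s^'-]) -> cvg (g x @[x --> s^'-]) ->
  cvg (cut_fun c f g x @[x --> s^'-]).
Proof.
move=> cf cg; have [sc|cs] := leP s c.
  apply: is_cvg_near_eq cf; near=> r; rewrite /cut_fun ifT//.
  by apply: lt_le_trans sc; near: r; exact: nbhs_left_lt.
by apply: is_cvg_near_eq cg; apply: cvg_within; exact: cut_fun_near_gt.
Unshelve. all: by end_near. Qed.

Lemma cut_fun_right (V : ptopologicalType) (c : R) (f g : R -> V) (s : R) :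
  cvg (f x @[x --> s^'+]) -> cvg (g x @[x --> s^'+]) ->
  cvg (cut_fun c f g x @[x --> s^'+]).
Proof.
move=> cf cg; have [cs|sc] := leP c s; last first.
  by apply: is_cvg_near_eq cf; apply: cvg_within; exact: cut_fun_near_lt.
apply: is_cvg_near_eq cg; near=> r; rewrite /cut_fun ifF//; apply/negbTE.
by rewrite -leNgt ltW//; apply: le_lt_trans cs _; near: r; exact: nbhs_right_gt.
Unshelve. all: by end_near. Qed.

(** Induction on the number of intervals. Continuity and one-sided limits are claimed on the whole
    line, so that a new piece can be glued on without endpoint cases. *)
Lemma steer_switched (n m k : nat) (A : nat -> 'M[R]_n) (B : 'M[R]_(n, m))
    (t : nat -> R) (x0 : 'cV[R]_n) (w : nat -> 'cV[R]_(\sum_(j < n) m)) :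
  (forall i, (i < k)%N -> t i < t i.+1) ->
  exists (u : R -> 'cV[R]_m) (x : R -> 'cV[R]_n),
    [/\ exists d : seq R, forall s, s \notin d -> {for s, continuous u},
        forall s, cvg (u r @[r --> s^'+]) /\ cvg (u r @[r --> s^'-]),
        continuous x,
        forall i, (i < k)%N -> forall s : R, t i < s < t i.+1 ->
          is_derive s 1 x (A i.+1 *m x s + B *m u s) &
        x (t 0%N) = x0 /\
        forall i, (i < k)%N -> x (t i.+1) =
          expm ((t i.+1 - t i) *: A i.+1) *m x (t i) +
          ctrb_mx (A i.+1) B *m w i.+1].
Proof.
elim: k => [|k IH] tS.
  exists (fun=> 0), (fun=> x0); split=> //.
  - by exists [::] => s _; exact: cvg_cst.
  - by move=> s; split; exact: is_cvg_cst.
  - by move=> s; exact: cvg_cst.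
have tS' i : (i < k)%N -> t i < t i.+1 by move=> ik; apply: tS; exact: ltnW.
have [u [x [[d ud] ulr xc xd [x00 xt]]]] := IH tS'.
have [U [X [Uc Xd Xa Xb]]] :=
  steer_interval (A k.+1) B (x (t k)) (w k.+1) (tS k (leqnn _)).
(* The state is [x] up to [c] and [X] afterwards; writing it with [min] and [max] makes its
   continuity a matter of composition. *)
pose c := t k; pose x' s := x (Num.min s c) + (X (Num.max s c) - X c).
have tc i : (i <= k)%N -> t i <= c.
  by move=> ik; apply: (switch_mono tS'); rewrite ik leqnn.
have Xc : continuous X by move=> s; exact: is_derive_mx_continuous (Xd s).
have x'l s : s <= c -> x' s = x s.
  by move=> sc; rewrite /x' min_l// max_r// subrr addr0.
have x'r s : c <= s -> x' s = X s.
  by move=> cs; rewrite /x' min_r// max_l// Xa addrC subrK.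
exists (cut_fun c u U), x'; split.
(* The switching time is the only new possible discontinuity of the input. *)
- exists (c :: d) => s; rewrite inE negb_or => /andP[sc sd].
  have [lsc|lcs|sE] := ltgtP s c; last by rewrite sE eqxx in sc.
    by apply: (continuous_near_eq (cut_fun_near_lt _ _ lsc)); exact: ud.
  by apply: (continuous_near_eq (cut_fun_near_gt _ _ lcs)); exact: Uc.
- move=> s; have [ur ul] := ulr s; split.
    apply: (@cut_fun_right _ c u U s ur); apply: (cvgP (U s)).
    by apply: cvg_at_right_filter; exact: Uc.
  apply: (@cut_fun_left _ c u U s ul); apply: (cvgP (U s)).
  by apply: cvg_at_left_filter; exact: Uc.
- move=> s; apply: (@cvgD R 'cV[R]_n).
    apply: (@cvg_comp _ _ _ (fun s => Num.min s c) x); last exact: xc.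
    by apply: (@continuous_min _ _ id (cst c)); [exact: cvg_id | exact: cvg_cst].
  apply: (@cvgB R 'cV[R]_n); last exact: cvg_cst.
  apply: (@cvg_comp _ _ _ (fun s => Num.max s c) X); last exact: Xc.
  by apply: (@continuous_max _ _ id (cst c)); [exact: cvg_id | exact: cvg_cst].
- move=> i; rewrite ltnS leq_eqVlt => /predU1P[->|ik] s /andP[ts st].
    rewrite x'r ?(ltW ts)// /cut_fun ifF; last by apply/negbTE; rewrite -leNgt ltW.
    apply: (near_eq_is_derive _ (Xd s)); near=> r; rewrite x'r// ltW//.
    by near: r; exact: lt_nbhsr.
  have sc : s < c by apply: lt_le_trans st (tc _ ik).
  rewrite x'l ?(ltW sc)// /cut_fun sc.
  have dxs : is_derive s 1 x (A i.+1 *m x s + B *m u s) by apply: xd => //; rewrite ts.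
  apply: (near_eq_is_derive _ dxs); near=> r; rewrite x'l// ltW//.
  by near: r; exact: lt_nbhsl.
- rewrite x'l ?tc//; split=> // i; rewrite ltnS leq_eqVlt => /predU1P[->|ik].
    by rewrite x'r ?Xb ?x'l// ltW// tS.
  by rewrite !x'l ?tc// ?xt// ltnW.
Unshelve. all: by end_near. Qed.

End Gluing.

(** * The temporal controllability matrix *)

Section Temporal.
Variable R : realType.

Lemma trans_prodpp (n p : nat) (A : nat -> 'M[R]_n) (t : nat -> R) :
  trans_prod p A t p = 1%:M.
Proof. by rewrite /trans_prod subnn big_geq. Qed.

Lemma trans_prodS (n p : nat) (A : nat -> 'M[R]_n) (t : nat -> R) i :
  (i < p)%N ->
  trans_prod p A t i =
  trans_prod p A t i.+1 *m expm ((t i.+1 - t i) *: A i.+1).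
Proof.
move=> ip; rewrite /trans_prod -(subnSK ip) big_nat_recr//= mulmxE.
by rewrite subKn.
Qed.

(** Column block [k] belongs to interval [p - k]; reversing the order of the blocks gives a sum in
    chronological order. *)
Lemma temporal_ctrb_mx_mul (n m p : nat) (A : nat -> 'M[R]_n)
    (B : 'M[R]_(n, m)) (t : nat -> R) (w : nat -> 'cV[R]_(\sum_(j < n) m)) :
  temporal_ctrb_mx p A B t *m (\mxcol_(k < p) w (p - k)%N) =
  \sum_(i < p) trans_prod p A t i.+1 *m ctrb_mx (A i.+1) B *m w i.+1.
Proof.
rewrite /temporal_ctrb_mx mul_mxrow_mxcol (reindex_inj rev_ord_inj) /=.
by apply: eq_bigr => i _; rewrite subKn.
Qed.

Lemma mxcol_rev_surj (n m p : nat) (y : 'cV[R]_(\sum_(k < p) \sum_(j < n) m)) :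
  exists w : nat -> 'cV[R]_(\sum_(j < n) m), y = \mxcol_(k < p) w (p - k)%N.
Proof.
case: p y => [|p] y; first by exists (fun=> 0); apply/mxcolP => -[].
exists (fun i => submxcol y (inord (p.+1 - i))).
rewrite -{1}[y]submxcolK; apply/eq_mxcolP => k.
by rewrite subKn ?inord_val// ltnW.
Qed.

(** The column space is cut out by the left annihilators of [C]; the transposed cokernel of [C^T] is
    one [Q] that tests them all. *)
Lemma annihilated_submx (F : fieldType) (n q : nat) (C : 'M[F]_(n, q)) (v : 'cV[F]_n) :
  (forall r (Q : 'M[F]_(r, n)), Q *m C = 0 -> Q *m v = 0) ->
  exists y : 'cV[F]_q, C *m y = v.
Proof.
move=> QCv; have : (v^T <= C^T)%MS.
  rewrite submxE; apply/eqP/trmx_inj; rewrite trmx_mul trmxK trmx0; apply: QCv.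
  by apply: trmx_inj; rewrite trmx_mul trmxK trmx0 mulmx_coker.
by case/submxP => y vE; exists y^T; apply: trmx_inj; rewrite trmx_mul trmxK.
Qed.

Lemma annihilated_blocks (r n m p : nat) (Q : 'M[R]_(r, n)) (A : nat -> 'M[R]_n)
    (B : 'M[R]_(n, m)) (t : nat -> R) :
  Q *m temporal_ctrb_mx p A B t = 0 ->
  forall i j, (i < p)%N -> (j < n)%N ->
    Q *m trans_prod p A t i.+1 *m A i.+1 ^+ j *m B = 0.
Proof.
rewrite /temporal_ctrb_mx mul_mxrow -mxrow0 => /eq_mxrowP Q0 i j ip jn.
have := Q0 (rev_ord (Ordinal ip)); rewrite /= subKn// mulmxA /ctrb_mx mul_mxrow.
rewrite -mxrow0 => /eq_mxrowP/(_ (Ordinal jn)) /=.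
by rewrite mulmxA.
Qed.

(** This is variation of constants seen through [P], without an integral of the input: [g] below is
    constant because its derivative vanishes off [d]. *)
Lemma annihilated_step (r n m : nat) (P : 'M[R]_(r, n)) (A : 'M[R]_n)
    (B : 'M[R]_(n, m)) (a b : R) (d : seq R) (u : R -> 'cV[R]_m)
    (x : R -> 'cV[R]_n) :
  a <= b -> (forall j, (j < n)%N -> P *m A ^+ j *m B = 0) ->
  {within `[a, b], continuous x} ->
  (forall s, a < s < b -> s \notin d ->
     is_derive s (1 : R) x (A *m x s + B *m u s)) ->
  P *m x b = P *m expm ((b - a) *: A) *m x a.
Proof.
move=> ab PB xc xd; apply/esym.
pose g s := P *m expm ((b - s) *: A) *m x s.
have -> : P *m x b = g b by rewrite /g subrr scale0r expm0 mulmx1.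
have dE (s : R) : is_derive s 1 (fun s => P *m expm ((b - s) *: A))
    (- (P *m expm ((b - s) *: A) *m A)).
  have d1 : is_derive s 1 (fun s : R => b - s) (-1).
    by apply: is_derive_eq; rewrite add0r mul1r.
  have d2 := @is_derive_mx_comp _ _ _ (fun s => expm (s *: A)) (fun s => b - s) s _ _
    (is_derive_expm A (b - s)) d1.
  have d3 : is_derive s 1 (fun _ : R => P) 0 by exact: is_derive_cst.
  apply: (is_derive_eq (is_derive_mulmx d3 d2)).
  by rewrite mul0mx add0r scaleN1r mulmxN expm_comm mulmxA.
rewrite -/(g a); apply/matrixP => i j.
apply: (@derive0_off_seq_cst _ (fun s => g s i j) d) => //.
  move=> s; suff : g @ nbhs (s : subspace `[a, b]) --> g s by move=> /cvg_mxP; exact.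
  apply: cvg_mulmx; last exact: xc.
  apply: continuous_subspaceT => z; exact: is_derive_mx_continuous (dE z).
move=> s sab sd; suff /is_derive_mxP/(_ i j) : is_derive s 1 g 0 by rewrite mxE.
(* The two terms in [A] cancel, and the input term contains [P *m expm _ *m B], a series whose terms
   all vanish. *)
apply: (is_derive_eq (is_derive_mulmx (dE s) (xd s sab sd))).
rewrite mulNmx mulmxDr !mulmxA addrA addNr add0r.
rewrite (_ : P *m _ *m B = 0) ?mul0mx//; apply: expm_eq0 => k.
by rewrite expmx_scale -scalemxAr -scalemxAl mulmx_expmx_eq0 ?scaler0.
Qed.

End Temporal.

(** * Herdability *)

Section Herdable.
Variable R : realType.

Lemma solution_annihilated (r n m p : nat) (A : nat -> 'M[R]_n)
    (B : 'M[R]_(n, m)) (t : nat -> R) (Q : 'M[R]_(r, n))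
    (u : R -> 'cV[R]_m) (x : R -> 'cV[R]_n) :
  (forall i, (i < p)%N -> t i < t i.+1) ->
  piecewise_continuous (t 0%N) (t p) u -> switched_solution p A B t u x ->
  Q *m temporal_ctrb_mx p A B t = 0 ->
  Q *m x (t p) = Q *m trans_prod p A t 0 *m x (t 0%N).
Proof.
move=> tS [d [ud _]] [xc xd] QC.
have tm := switch_mono tS.
(* The invariant transports the state at [t k] to the final time by the free motion; under [Q] it
   does not depend on [k]. *)
suff H k : (k <= p)%N ->
    Q *m trans_prod p A t k *m x (t k) = Q *m trans_prod p A t 0 *m x (t 0%N).
  by rewrite -(H p (leqnn p)) trans_prodpp mulmx1.
elim: k => // k IH kp; rewrite -IH ?(ltnW kp)//.
rewrite (trans_prodS _ _ kp) mulmxA.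
apply: (@annihilated_step _ _ _ _ _ (A k.+1) B (t k) (t k.+1) d u).
- exact/ltW/tS.
- by move=> j jn; exact: annihilated_blocks QC _ _ kp jn.
- apply: continuous_subspaceW xc => s /=; rewrite !in_itv/= => /andP[ks sk].
  apply/andP; split; first by apply: le_trans ks; apply: tm; rewrite leq0n ltnW.
  by apply: le_trans sk _; apply: tm; rewrite kp leqnn.
- move=> s /andP[ks sk] sd; apply: xd => //=; first by rewrite ks.
  apply: ud => //; apply/andP; split.
    by apply: le_lt_trans ks; apply: tm; rewrite leq0n ltnW.
  by apply: lt_le_trans sk _; apply: tm; rewrite kp leqnn.
Qed.

Lemma steer_temporal (n m p : nat) (A : nat -> 'M[R]_n) (B : 'M[R]_(n, m))
    (t : nat -> R) (x0 : 'cV[R]_n)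
    (y : 'cV[R]_(\sum_(k < p) \sum_(j < n) m)) :
  (forall i, (i < p)%N -> t i < t i.+1) ->
  exists u, piecewise_continuous (t 0%N) (t p) u /\ exists x,
    [/\ switched_solution p A B t u x, x (t 0%N) = x0 &
        x (t p) = trans_prod p A t 0 *m x0 + temporal_ctrb_mx p A B t *m y].
Proof.
move=> tS; have [w ->] := mxcol_rev_surj y.
have [u [x [[d ud] ulr xc xd [x00 xt]]]] := steer_switched A B x0 w tS.
exists u; split.
  exists d; split; first by move=> s _; exact: ud.
  by split=> s _; have [] := ulr s.
exists x; split=> //.
  split; first exact: continuous_subspaceT.
  by move=> [//|i] ip s /= si _; exact: xd.
rewrite temporal_ctrb_mx_mul.
(* The same transported state now gains one summand of the temporal matrix product per interval. *)
suff H k : (k <= p)%N -> trans_prod p A t k *m x (t k) = trans_prod p A t 0 *m x0 +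
    \sum_(i < k) trans_prod p A t i.+1 *m ctrb_mx (A i.+1) B *m w i.+1.
  by rewrite -(H p (leqnn p)) trans_prodpp mul1mx.
elim: k => [_|k IH kp]; first by rewrite big_ord0 addr0 x00.
rewrite big_ord_recr /= addrA -IH ?(ltnW kp)// xt// mulmxDr !mulmxA.
by rewrite -(trans_prodS _ _ kp).
Qed.

End Herdable.

Theorem mainTheorem1 (R : realType) (n m p : nat) (A : nat -> 'M[R]_n)
    (B : 'M[R]_(n, m)) (t : nat -> R) :
  (0 < p)%N ->
  (forall i : nat, (i < p)%N -> t i < t i.+1) ->
  completely_herdable p A B t <->
  exists v : 'cV[R]_n, (forall j : 'I_n, 0 < v j 0) /\
    exists y : 'cV[R]_(\sum_(k < p) \sum_(j < n) m),
      temporal_ctrb_mx p A B t *m y = v.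
Proof.
move=> _ tS; split=> [herd|[v [v0 [y yv]]] x0 h h0].
  (* Starting at the origin with threshold 1, the state reached is itself the positive vector
     sought. *)
  have [u [up [x [xs [x0 x1]]]]] := herd 0 1 ltr01.
  exists (x (t p)); split=> [j|]; first exact: lt_le_trans ltr01 (x1 j).
  apply: annihilated_submx => r Q QC.
  by rewrite (solution_annihilated tS up xs QC) x0 mulmx0.
pose z := trans_prod p A t 0 *m x0.
(* The sum of these nonnegative ratios bounds each of them, so [a * v j 0] exceeds [h] by enough to
   absorb the free motion [z] at every node. *)
pose a := \sum_j (h + `|z j 0|) / v j 0.
have [u [up [x [xs xt0 xtp]]]] := steer_temporal A B x0 (a *: y) tS.
exists u; split=> //; exists x; split=> //; split=> // j.
rewrite xtp -scalemxAr yv -/z mxE [X in _ <= _ + X]mxE.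
have hz i : 0 <= (h + `|z i 0|) / v i 0.
  by rewrite divr_ge0 ?(ltW (v0 i))// addr_ge0// ltW.
have av : h + `|z j 0| <= a * v j 0.
  by rewrite -ler_pdivrMr ?v0// /a (bigD1 j)//= lerDl sumr_ge0.
rewrite -lerBlDl (le_trans _ av)// lerD2l -normrN ler_norm//.
Qed.
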